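(* Let $X$ be a metric space and $f:X\to X$ a continuous surjective map. If $(X,f)$ is positively expansive and has the shadowing property, then $(X,f)$ has the asymptotic shadowing property.
   Context: Let $\omega=\{0,1,2,\dots\}$. $X$ is not assumed compact. $(X,f)$ is positively expansive if there is a constant $c>0$ such that whenever $x,y\in X$ satisfy $d(f^n(x),f^n(y))<c$ for all $n\in\omega$, then $x=y$. For $\delta>0$, a $\delta$-pseudo-orbit is a sequence $\langle x_i\rangle_{i\in\omega}$ in $X$ with $d(f(x_i),x_{i+1})<\delta$ for all $i$; an asymptotic pseudo-orbit is a sequence in $X$ with $d(f(x_i),x_{i+1})\to0$ as $i\to\infty$. $(X,f)$ has the shadowing property if for all $\epsilon>0$ there exists $\delta>0$ such that for every $\delta$-pseudo-orbit $\langle x_i\rangle$ there is $z\in X$ with $d(f^i(z),x_i)<\epsilon$ for all $i\in\omega$. $(X,f)$ has the asymptotic shadowing property if for every asymptotic pseudo-orbit $\langle x_i\rangle$ there is $z\in X$ with $d(f^i(z),x_i)\to0$ as $i\to\infty$. *)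

(* Defs.v *)
From mathcomp Require Import all_boot all_order all_algebra.
From mathcomp Require Import boolp classical_sets reals topology normedtype.
From mathcomp Require Import sequences.

Set Implicit Arguments.
Unset Strict Implicit.
Unset Printing Implicit Defensive.

Import Order.TTheory GRing.Theory Num.Theory.
Import numFieldNormedType.Exports.

Local Open Scope classical_set_scope.
Local Open Scope ring_scope.

Definition positively_expansive (R : realType) (X : metricType R)
    (f : X -> X) : Prop :=
  exists2 c : R, 0 < c &
    forall x y : X,
      (forall n : nat, mdist (iter n f x) (iter n f y) < c) -> x = y.

Definition pseudo_orbit (R : realType) (X : metricType R) (f : X -> X)
    (delta : R) (x : nat -> X) : Prop :=
  forall i : nat, mdist (f (x i)) (x i.+1) < delta.

Definition asymptotic_pseudo_orbit (R : realType) (X : metricType R)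
    (f : X -> X) (x : nat -> X) : Prop :=
  mdist (f (x i)) (x i.+1) @[i --> \oo] --> (0 : R).

Definition shadowing_property (R : realType) (X : metricType R)
    (f : X -> X) : Prop :=
  forall epsilon : R, 0 < epsilon ->
    exists2 delta : R, 0 < delta &
      forall x : nat -> X, pseudo_orbit f delta x ->
        exists z : X, forall i : nat, mdist (iter i f z) (x i) < epsilon.

Definition asymptotic_shadowing_property (R : realType) (X : metricType R)
    (f : X -> X) : Prop :=
  forall x : nat -> X, asymptotic_pseudo_orbit f x ->
    exists z : X, mdist (iter i f z) (x i) @[i --> \oo] --> (0 : R).

(* Main.v *)
(** Expansivity makes shadowing points of tails unique.  Fix an expansivity
    constant [c] and a point [z] shadowing a tail of the asymptotic
    pseudo-orbit within [c / 2].  For every [e <= c / 2], a point shadowing a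
    later tail within [e] stays [c]-close to the corresponding iterate of [z],
    hence equals it; thus [z] shadows asymptotically.  By surjectivity, [z] is
    then pulled back to time 0. *)

Require Import Defs.
From mathcomp Require Import all_boot all_order all_algebra.
From mathcomp Require Import boolp classical_sets reals topology normedtype.
From mathcomp Require Import sequences.

Import Order.TTheory GRing.Theory Num.Theory.
Import numFieldNormedType.Exports.

Local Open Scope classical_set_scope.
Local Open Scope ring_scope.

Lemma iter_surjective {T : Type} {f : T -> T} :
  (forall y, exists x, f x = y) -> forall n y, exists x, iter n f x = y.
Proof.
move=> fsurj; elim=> [|n IHn] y; first by exists y.
have [y' <-] := fsurj y; have [x <-] := IHn y'.
by exists x.
Qed.

Lemma mdist_cvg0P {R : realType} {X : metricType R} (u v : nat -> X) :
  mdist (u i) (v i) @[i --> \oo] --> (0 : R) <->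
  forall e : R, 0 < e ->
    exists N, forall i, (N <= i)%N -> mdist (u i) (v i) < e.
Proof.
split=> [/cvgrPdist_lt uv e e0|uv].
  have [N _ NP] := uv e e0; exists N => i /NP /=.
  by rewrite sub0r normrN ger0_norm ?mdist_ge0.
apply/cvgrPdist_lt => e e0; have [N NP] := uv e e0.
exists N => // i /NP /=.
by rewrite sub0r normrN ger0_norm ?mdist_ge0.
Qed.

Section TailShadowing.
Context {R : realType} {X : metricType R} {f : X -> X}.

(** Once the errors stay below the [d] that shadowing assigns to [e], the remaining tail is a
    [d]-pseudo-orbit. The bound [M] lets the tail start after any prescribed time. *)
Lemma shadowing_tail (x : nat -> X) (e : R) (M : nat) :
  shadowing_property f -> asymptotic_pseudo_orbit f x -> 0 < e ->
  exists2 N, (M <= N)%N &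
    exists z, forall i, mdist (iter i f z) (x (N + i)%N) < e.
Proof.
move=> fsh /(mdist_cvg0P (f \o x) (x \o succn)) xasy e0.
have [d d0 dP] := fsh e e0; have [N NP] := xasy d d0.
exists (maxn M N); first exact: leq_maxl.
apply: (dP (fun i => x (maxn M N + i)%N)) => i; rewrite addnS.
exact/NP/(leq_trans (leq_maxr M N))/leq_addr.
Qed.

Lemma expansive_shadow_unique (c : R) (y : nat -> X) (z z' : X) :
  (forall x x', (forall n, mdist (iter n f x) (iter n f x') < c) -> x = x') ->
  (forall i, mdist (iter i f z) (y i) < c / 2) ->
  (forall i, mdist (iter i f z') (y i) < c / 2) -> z = z'.
Proof.
move=> fexp zy z'y; apply: fexp => n.
rewrite (le_lt_trans (metric_triangle _ (y n) _))// [c]splitr.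
by rewrite ltrD// metric_sym.
Qed.

End TailShadowing.

Theorem theorem12 (R : realType) (X : metricType R) (f : X -> X)
  (f_continuous : continuous f)
  (f_surjective : forall y : X, exists x : X, f x = y)
  (f_expansive : positively_expansive f)
  (f_shadowing : shadowing_property f) :
  asymptotic_shadowing_property f.
Proof.
move=> x xasy; have [c c0 fexp] := f_expansive.
have c20 : 0 < c / 2 by rewrite divr_gt0.
have [N _ [z zP]] := shadowing_tail x (c / 2) 0%N f_shadowing xasy c20.
have [w wz] := iter_surjective f_surjective N z.
exists w; apply/(mdist_cvg0P (fun i => iter i f w)) => e e0.
(* The bound [e] serves the convergence, [c / 2] the uniqueness of the shadowing point. *)
have m0 : 0 < Num.min e (c / 2) by rewrite lt_min e0.
have [M NM [z' z'P]] := shadowing_tail x _ N f_shadowing xasy m0.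
(* As [N <= M], [iter M f w] is [iter (M - N) f z], which inherits from [z] the [c / 2]-shadowing of
   the tail from [M]. *)
have wz' : iter M f w = z'.
  apply: (expansive_shadow_unique c (fun i => x (M + i)%N) _ _ fexp) => i.
    have := zP (i + (M - N))%N.
    by rewrite -wz -iterD -addnA subnK// iterD addnCA subnKC// [(i + M)%N]addnC.
  by have := z'P i; rewrite lt_min => /andP[].
(* From time [M] on, the orbit of [w] is that of [z'], hence [e]-close to [x]. *)
exists M => i Mi; have := z'P (i - M)%N.
by rewrite lt_min -wz' -iterD subnK// subnKC// => /andP[].
Qed.
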